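(* Suppose that $(\mathcal{M},\varphi,\varphi')$ is an infinitesimal probability space, and let $N\in\mathbb{N}$ be fixed. If the sets $\{a^{(1)}_{i,j}: 1\le i,j\le N\},\dots,\{a^{(k)}_{i,j}: 1\le i,j\le N\}$ are infinitesimally Boolean independent in $\mathcal{M}$, then the elements $[a^{(1)}_{i,j}]_{i,j=1}^N,\dots,[a^{(k)}_{i,j}]_{i,j=1}^N$ are infinitesimally Boolean independent in $M_N(\mathcal{M})$ over $M_N(\mathbb{C})$.
   Context: An infinitesimal probability space $(\mathcal{M},\varphi,\varphi')$ is a unital complex algebra $\mathcal{M}$ with linear functionals $\varphi,\varphi':\mathcal{M}\to\mathbb{C}$ such that $\varphi(1)=1$, $\varphi'(1)=0$. An operator-valued infinitesimal probability space $(\mathcal{A},\mathcal{B},E,E')$ is a unital algebra $\mathcal{A}$, a unital subalgebra $\mathcal{B}$, and linear maps $E,E':\mathcal{A}\to\mathcal{B}$ with $E(b)=b$, $E(bab')=bE(a)b'$, $E'(1)=0$, $E'(bab')=bE'(a)b'$ for $a\in\mathcal{A}$, $b,b'\in\mathcal{B}$; the scalar case is $\mathcal{B}=\mathbb{C}$, $E=\varphi$, $E'=\varphi'$. Here $M_N(\mathcal{M})$ is regarded as the operator-valued infinitesimal probability space with $\mathcal{A}=M_N(\mathcal{M})$, $\mathcal{B}=M_N(\mathbb{C})$, $E=\varphi\otimes \mathrm{Id}_N$, $E'=\varphi'\otimes \mathrm{Id}_N$ (entrywise application). Subalgebras $(\mathcal{A}_i)_{i\in I}$ of $\mathcal{A}$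 containing $\mathcal{B}$ are infinitesimally Boolean independent over $\mathcal{B}$ if for all $n\in\mathbb{N}$, $i_1\ne i_2\ne\cdots\ne i_n$ in $I$ (consecutive indices distinct) and $a_j\in\mathcal{A}_{i_j}$, $$E(a_1\cdots a_n)=E(a_1)\cdots E(a_n),\qquad E'(a_1\cdots a_n)=\sum_{j=1}^n E(a_1)\cdots E(a_{j-1})E'(a_j)E(a_{j+1})\cdots E(a_n).$$ Elements, or sets of elements, are infinitesimally Boolean independent over $\mathcal{B}$ if the unital algebras they generate (as subalgebras containing $\mathcal{B}$) are. *)

(* Defs.v *)
From HB Require Import structures.
From mathcomp Require Import all_boot all_order all_algebra.
From mathcomp Require Import complex.
From mathcomp Require Import boolp classical_sets reals.

Set Implicit Arguments.
Unset Strict Implicit.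
Unset Printing Implicit Defensive.

Import GRing.Theory.
Local Open Scope classical_set_scope.
Local Open Scope ring_scope.

(* An infinitesimal probability space on the unital algebra M over K;
   the scalars are written K^o where they are seen as an algebra over K. *)
Record inf_prob_space (K : comNzRingType) (M : algType K) := InfProbSpace {
  phi : {linear M -> K^o};
  phi' : {linear M -> K^o};
  phi_1 : phi 1 = 1;
  phi'_1 : phi' 1 = 0 }.

(* The subalgebra B of A is given by its inclusion map [incl]; [ovE_id] forces
   it to be injective. *)
Record ov_inf_prob_space (K : comNzRingType) (A B : algType K) :=
  OvInfProbSpace {
  incl : {lrmorphism B -> A};
  ovE : {linear A -> B};
  ovE' : {linear A -> B};
  ovE_id : forall b, ovE (incl b) = b;
  ovE_bimod : forall b a b', ovE (incl b * a * incl b') = b * ovE a * b';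
  ovE'_1 : ovE' 1 = 0;
  ovE'_bimod : forall b a b', ovE' (incl b * a * incl b') = b * ovE' a * b' }.

Section Independence.
Variables (K : comNzRingType) (A B : algType K) (P : ov_inf_prob_space A B).

Definition is_subalgebra (S : set A) : Prop := GRing.subalg_closed (mem S).

(* The products over 'I_n are taken in increasing order of the index, so the
   factors are never permuted. *)
Definition inf_boolean_independent (I : Type) (S : I -> set A) : Prop :=
  [/\ forall i, is_subalgebra (S i),
      forall i, range (incl P) `<=` S i &
      forall (n : nat) (i : 'I_n -> I) (a : 'I_n -> A),
        (forall j l : 'I_n, l = j.+1 :> nat -> i j <> i l) ->
        (forall j, S (i j) (a j)) ->
        ovE P (\prod_(j < n) a j) = \prod_(j < n) ovE P (a j) /\
        ovE' P (\prod_(j < n) a j) =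
          \sum_(j < n) (\prod_(l < n | (l < j)%N) ovE P (a l)) * ovE' P (a j)
                       * (\prod_(l < n | (j < l)%N) ovE P (a l))].

Definition generated_algebra (X : set A) : set A :=
  smallest is_subalgebra (range (incl P) `|` X).

Definition inf_boolean_independent_sets (I : Type) (X : I -> set A) : Prop :=
  inf_boolean_independent (fun i => generated_algebra (X i)).

Definition inf_boolean_independent_elements (I : Type) (x : I -> A) : Prop :=
  inf_boolean_independent_sets (fun i => [set x i]).

End Independence.

Section ScalarSpace.
Variables (K : comNzRingType) (M : algType K) (P : inf_prob_space M).

Definition scalar_incl (c : K^o) : M := c%:A.

Fact scalar_incl_is_linear : linear scalar_incl.
Proof. by move=> c x y; rewrite /scalar_incl scalerDl scalerA. Qed.
HB.instance Definition _ :=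
  GRing.isLinear.Build K K^o M *:%R scalar_incl scalar_incl_is_linear.
Fact scalar_incl_is_monoid_morphism : monoid_morphism scalar_incl.
Proof.
split=> [|x y]; first by rewrite /scalar_incl scale1r.
by rewrite /scalar_incl -scalerAl mul1r scalerA.
Qed.
HB.instance Definition _ :=
  GRing.isMonoidMorphism.Build K^o M scalar_incl scalar_incl_is_monoid_morphism.

Fact scalar_id c : phi P (scalar_incl c) = c.
Proof. by rewrite /scalar_incl linearZ /= phi_1 [_ *: _]mulr1. Qed.

Fact scalar_bimod (f : {linear M -> K^o}) b a b' :
  f (scalar_incl b * a * scalar_incl b') = b * f a * b'.
Proof.
rewrite /scalar_incl -scalerAl mul1r -scalerAr mulr1 !linearZ /=.
exact: mulrC.
Qed.

Definition scalar_space : ov_inf_prob_space M K^o :=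
  @OvInfProbSpace K M K^o scalar_incl (phi P) (phi' P)
    scalar_id (scalar_bimod (phi P)) (phi'_1 P) (scalar_bimod (phi' P)).

End ScalarSpace.

(* M_N(M) as an algebra over the ground ring K, with N = n.+1 >= 1; the library
   makes 'M[M]_n.+1 a module over M only, hence the alias. *)
Definition matrix_algebra (K : comNzRingType) (M : algType K) (n : nat) : Type :=
  'M[M]_n.+1.

Section MatrixAlgebra.
Variables (K : comNzRingType) (M : algType K) (n : nat).
Local Notation A := (matrix_algebra M n).

HB.instance Definition _ := GRing.NzRing.copy A 'M[M]_n.+1.

Definition matrix_scale (c : K) (X : A) : A := map_mx ( *:%R c) X.

Fact matrix_scaleA a b X :
  matrix_scale a (matrix_scale b X) = matrix_scale (a * b) X.
Proof. by apply/matrixP=> i j; rewrite !mxE scalerA. Qed.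
Fact matrix_scale1 : left_id 1 matrix_scale.
Proof. by move=> X; apply/matrixP=> i j; rewrite !mxE scale1r. Qed.
Fact matrix_scaleDr : right_distributive matrix_scale +%R.
Proof. by move=> c X Y; apply/matrixP=> i j; rewrite !mxE scalerDr. Qed.
Fact matrix_scaleDl X : {morph matrix_scale^~ X : a b / a + b}.
Proof. by move=> a b; apply/matrixP=> i j; rewrite !mxE scalerDl. Qed.
HB.instance Definition _ := GRing.Zmodule_isLmodule.Build K A
  matrix_scaleA matrix_scale1 matrix_scaleDr matrix_scaleDl.

Fact matrix_scaleE (c : K) (X : A) i j : (c *: X) i j = c *: X i j.
Proof. by rewrite mxE. Qed.

Fact matrix_scaleAl (c : K) (X Y : A) : c *: (X * Y) = (c *: X) * Y.
Proof.
apply/matrixP=> i j; rewrite !mxE scaler_sumr.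
by apply: eq_bigr => l _; rewrite !mxE scalerAl.
Qed.
HB.instance Definition _ := GRing.Lmodule_isLalgebra.Build K A matrix_scaleAl.

Fact matrix_scaleAr (c : K) (X Y : A) : c *: (X * Y) = X * (c *: Y).
Proof.
apply/matrixP=> i j; rewrite !mxE scaler_sumr.
by apply: eq_bigr => l _; rewrite !mxE scalerAr.
Qed.
HB.instance Definition _ := GRing.Lalgebra_isAlgebra.Build K A matrix_scaleAr.

Definition matrix_incl (X : 'M[K]_n.+1) : A := map_mx (in_alg M) X.

Fact matrix_incl_is_linear : linear matrix_incl.
Proof.
move=> c X Y; apply/matrixP=> i j.
by rewrite [RHS]mxE matrix_scaleE !mxE /= scalerDl scalerA.
Qed.
HB.instance Definition _ :=
  GRing.isLinear.Build K 'M[K]_n.+1 A *:%R matrix_incl matrix_incl_is_linear.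
Fact matrix_incl_is_monoid_morphism : monoid_morphism matrix_incl.
Proof. by split=> [|X Y]; rewrite /matrix_incl ?map_mx1 ?map_mxM. Qed.
HB.instance Definition _ := GRing.isMonoidMorphism.Build 'M[K]_n.+1 A
  matrix_incl matrix_incl_is_monoid_morphism.

Definition entrywise (f : {linear M -> K^o}) (X : A) : 'M[K]_n.+1 := map_mx f X.

Fact entrywise_is_linear f : linear (entrywise f).
Proof. by move=> c X Y; apply/matrixP=> i j; rewrite !mxE linearP. Qed.
HB.instance Definition _ f := GRing.isLinear.Build K A 'M[K]_n.+1 *:%R
  (entrywise f) (entrywise_is_linear f).

Fact entrywise_bimod (f : {linear M -> K^o}) b a b' :
  entrywise f (matrix_incl b * a * matrix_incl b') = b * entrywise f a * b'.
Proof.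
apply/matrixP=> i j; rewrite !mxE linear_sum; apply: eq_bigr => l _.
rewrite !mxE -scalerAr mulr1 linearZ /= linear_sum [LHS]mulrC; congr (_ * _).
by apply: eq_bigr => m _; rewrite !mxE -scalerAl mul1r linearZ.
Qed.

Variable P : inf_prob_space M.

Fact matrix_id b : entrywise (phi P) (matrix_incl b) = b.
Proof. by apply/matrixP=> i j; rewrite !mxE linearZ /= phi_1 [_ *: _]mulr1. Qed.

Fact matrix_E'1 : entrywise (phi' P) 1 = 0.
Proof.
by apply/matrixP=> i j; rewrite !mxE; case: eqP => _; rewrite ?phi'_1 ?linear0.
Qed.

Definition matrix_space : ov_inf_prob_space A 'M[K]_n.+1 :=
  @OvInfProbSpace K A 'M[K]_n.+1 matrix_incl
    (entrywise (phi P)) (entrywise (phi' P))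
    matrix_id (entrywise_bimod (phi P)) matrix_E'1 (entrywise_bimod (phi' P)).

End MatrixAlgebra.

(* Main.v *)
(** Every matrix in the algebra generated by a matrix [a r] over the scalar
    matrices has its entries in the algebra generated by the entries of [a r].
    An entry of a product of matrices is a sum of products of entries, each of
    which splits under [phi] and [phi'] by the scalar independence; summing up
    again gives the matrix identities.  For [phi'] the Leibniz sum is a sum,
    over the distinguished position, of products of the same shape, so that
    both identities are instances of one multilinear statement. *)
Require Import Defs.
From HB Require Import structures.
From mathcomp Require Import all_boot all_order all_algebra.
From mathcomp Require Import complex.
From mathcomp Require Import boolp classical_sets reals.

Set Implicit Arguments.
Unset Strict Implicit.
Unset Printing Implicit Defensive.

Import GRing.Theory.
Local Open Scope classical_set_scope.
Local Open Scope ring_scope.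

Lemma generated_algebra_subalgebra (K : comNzRingType) (A B : algType K)
    (P : ov_inf_prob_space A B) (X : set A) :
  is_subalgebra (generated_algebra P X).
Proof.
split=> [|c x y /set_mem Sx /set_mem Sy|x y /set_mem Sx /set_mem Sy];
  apply/mem_set => T [sT XT]; have [T1 TD TM] := sT.
- exact: set_mem T1.
- by apply/set_mem/TD; apply/mem_set; [apply: Sx | apply: Sy].
- by apply/set_mem/TM; apply/mem_set; [apply: Sx | apply: Sy].
Qed.

Lemma incl_generated_algebra (K : comNzRingType) (A B : algType K)
    (P : ov_inf_prob_space A B) (X : set A) :
  range (incl P) `<=` generated_algebra P X.
Proof. by move=> x Px T [_]; apply; left. Qed.

Lemma sub_generated_algebra (K : comNzRingType) (A B : algType K)
    (P : ov_inf_prob_space A B) (X : set A) : X `<=` generated_algebra P X.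
Proof. by move=> x Xx T [_]; apply; right. Qed.

Lemma subalgebra0 (K : comNzRingType) (A : algType K) (S : set A) :
  is_subalgebra S -> S 0.
Proof.
(* Zero is obtained as [-1 *: 1 + 1], from the unit and closure under [c *: x + y]. *)
by move=> [S1 SD _]; rewrite -(subrr 1) addrC -scaleN1r; apply/set_mem/SD.
Qed.

Lemma subalgebra_sum (K : comNzRingType) (A : algType K) (S : set A)
    (I : finType) (F : I -> A) :
  is_subalgebra S -> (forall i, S (F i)) -> S (\sum_i F i).
Proof.
move=> sS SF; have [_ SD _] := sS.
apply: big_ind => // [|x y Sx Sy]; first exact: subalgebra0.
by rewrite -[x]scale1r; apply/set_mem/SD; apply: mem_set.
Qed.

Lemma matrix_set_subalgebra (K : comNzRingType) (M : algType K) (n : nat)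
    (S : set M) :
  is_subalgebra S ->
  is_subalgebra [set X : matrix_algebra M n | forall i j, S (X i j)].
Proof.
move=> sS; have [S1 SD SM] := sS.
split=> [|c X Y /set_mem SX /set_mem SY|X Y /set_mem SX /set_mem SY];
  apply/mem_set => i j; last first.
- rewrite mxE; apply: subalgebra_sum => // l.
  by apply/set_mem/SM; apply: mem_set.
- by rewrite mxE matrix_scaleE; apply/set_mem/SD; apply: mem_set.
by rewrite mxE; case: eqP => _; [apply: set_mem S1 | apply: subalgebra0].
Qed.

(** By minimality: the matrices with all entries in [S] form a subalgebra that contains the scalar
    matrices and the generator. *)
Lemma generated_algebra_entries (K : comNzRingType) (M : algType K)
    (P : inf_prob_space M) (n : nat) (a : 'I_n.+1 -> 'I_n.+1 -> M)
    (X : matrix_algebra M n) :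
  generated_algebra (matrix_space n P)
    [set \matrix_(i, j) a i j : matrix_algebra M n] X ->
  forall i j, generated_algebra (scalar_space P)
    [set a i j | i in [set: 'I_n.+1] & j in [set: 'I_n.+1]] (X i j).
Proof.
set S := generated_algebra (scalar_space P) _ => genX.
apply: (genX [set Y | forall i j, S (Y i j)]).
split; first exact/matrix_set_subalgebra/generated_algebra_subalgebra.
move=> Y [[b _ <-] | ->] i j.
  by apply: incl_generated_algebra; exists (b i j); rewrite // mxE.
by apply: sub_generated_algebra; rewrite mxE; exists i => //; exists j.
Qed.

(** Turns a Leibniz term into one ordered product over all positions, the shape that
    [additive_matrix_prod] handles. *)
Lemma prod_distinguished (R : nzRingType) (m : nat) (F G : 'I_m -> R)
    (j : 'I_m) :
  (\prod_(l < m | (l < j)%N) F l) * G j * (\prod_(l < m | (j < l)%N) F l) =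
  \prod_(l < m) (if l == j then G l else F l).
Proof.
elim: m => [|m IHm] in F G j *; first by case: j.
(* Either [j] lies beyond the first position and [F ord0] splits off on the left, or [j = ord0] and
   the left product is empty. *)
rewrite [RHS]big_ord_recl; case: (unliftP ord0 j) => [j'|] ->.
  rewrite big_mkcond big_ord_recl -big_mkcond /=.
  rewrite [X in _ * _ * X]big_mkcond big_ord_recl -big_mkcond /= mul1r.
  have := IHm (fun l => F (lift ord0 l)) (fun l => G (lift ord0 l)) j'.
  rewrite -!mulrA => ->; congr (_ * _).
rewrite big_pred0 // mul1r; congr (_ * _).
by rewrite big_mkcond big_ord_recl /= mul1r.
Qed.

(* The weights [c] are there for the induction on [m], where the first factor
   becomes part of [Psi] on the left and of [c] on the right. *)
Lemma additive_matrix_prod (K : comNzRingType) (M : nzRingType) (n m : nat)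
    (S : finType) (Psi : {additive M -> K}) (c : S -> K)
    (psi : S -> 'I_m -> M -> K) (A : 'I_m -> 'M[M]_n.+1) :
  (forall p q : 'I_m -> 'I_n.+1,
    Psi (\prod_(j < m) A j (p j) (q j)) =
    \sum_s c s * \prod_(j < m) psi s j (A j (p j) (q j))) ->
  forall i l, Psi ((\prod_(j < m) A j) i l) =
    \sum_s c s * (\prod_(j < m) map_mx (psi s j) (A j)) i l.
Proof.
elim: m => [|m IHm] in Psi c psi A * => PsiA i l.
  (* With no factors the index choices are vacuous and the hypothesis reads [Psi 1 = \sum_s c s],
     which is the diagonal case; off the diagonal both sides vanish. *)
  have := PsiA (fun=> ord0) (fun=> ord0); rewrite !big_ord0 mxE.
  under eq_bigr do rewrite big_ord0.
  under [X in _ -> _ = X]eq_bigr do rewrite big_ord0 mxE.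
  case: eqP => _ Psi1; first exact: Psi1.
  by rewrite raddf0 big1 // => s _; rewrite mulr0.
(* Prepending [i] to the rows and [h] to the columns fixes the first entry as [A ord0 i h], with [h]
   the summation index of the matrix product. *)
pose cons x (f : 'I_m -> 'I_n.+1) j := oapp f x (unlift ord0 j).
rewrite big_ord_recl mxE raddf_sum /=.
transitivity (\sum_h \sum_s c s * psi s ord0 (A ord0 i h) *
  (\prod_(j < m) map_mx (psi s (lift ord0 j)) (A (lift ord0 j))) h l).
  apply: eq_bigr => h _.
  have := IHm (Psi \o (A ord0 i h \*o idfun) : {additive M -> K})
    (fun s => c s * psi s ord0 (A ord0 i h)) (fun s j => psi s (lift ord0 j)).
  apply=> p q /=; have := PsiA (cons i p) (cons h q).
  rewrite big_ord_recl /cons unlift_none /=.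
  under eq_bigr do rewrite liftK /=.
  move=> ->; apply: eq_bigr => s _.
  rewrite big_ord_recl unlift_none /= mulrA; congr (_ * _).
  by apply: eq_bigr => j _; rewrite liftK.
rewrite exchange_big; apply: eq_bigr => s _.
rewrite [in RHS]big_ord_recl [in RHS]mxE mulr_sumr; apply: eq_bigr => h _.
by rewrite mxE mulrA.
Qed.

Theorem theorem1p3 (R : realType) (M : algType R[i]) (P : inf_prob_space M)
    (n k : nat) (a : 'I_k -> 'I_n.+1 -> 'I_n.+1 -> M) :
  inf_boolean_independent_sets (scalar_space P)
    (fun r : 'I_k => [set a r i j | i in [set: 'I_n.+1] & j in [set: 'I_n.+1]]) ->
  inf_boolean_independent_elements (matrix_space n P)
    (fun r : 'I_k => \matrix_(i < n.+1, j < n.+1) a r i j).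
Proof.
move=> [_ _ indep]; split=> [r|r|m i A neq_i genA].
- exact: generated_algebra_subalgebra.
- exact: incl_generated_algebra.
have {indep} indep p q := indep m i (fun j => A j (p j) (q j)) neq_i
  (fun j => generated_algebra_entries (genA j) (p j) (q j)).
split; apply/matrixP => p q.
  (* Multiplicativity of [phi] is the case of a single summand. *)
  have := @additive_matrix_prod _ M n m 'I_1 (phi P) (fun=> 1)
    (fun _ _ => phi P) A.
  rewrite [LHS]mxE => -> => [|f g]; rewrite big_ord1 mul1r //.
  by have [] := indep f g.
(* Here [s] is the position that receives [phi']. *)
have := @additive_matrix_prod _ M n m 'I_m (phi' P) (fun=> 1)
  (fun s j => if j == s then phi' P else phi P) A.
rewrite [LHS]mxE => -> => [|f g].
  rewrite summxE; apply: eq_bigr => s _.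
  rewrite mul1r; congr (fun_of_matrix _ p q); apply/esym.
  rewrite (prod_distinguished (fun j => ovE (matrix_space n P) (A j))
    (fun j => ovE' (matrix_space n P) (A j))).
  by apply: eq_bigr => j _; case: eqP.
have [_ E'A] := indep f g; apply: etrans E'A _; apply: eq_bigr => s _.
rewrite mul1r (prod_distinguished (fun j => phi P (A j (f j) (g j)))
  (fun j => phi' P (A j (f j) (g j)))).
by apply: eq_bigr => j _; case: eqP.
Qed.
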